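(* Let $\mathcal H$ be a complex separable infinite-dimensional Hilbert space and let $(\eta(z),\xi(z))$, $z\in\mathbb C$, be a pair of Riesz bicoherent states in $\mathcal H$, i.e. $\eta(z)=T\Phi(z)$ and $\xi(z)=(T^{-1})^\dagger\Phi(z)$ for all $z\in\mathbb C$, where $T$ is a bounded operator on $\mathcal H$ with bounded inverse $T^{-1}$ and $\Phi(z)$, $z\in\mathbb C$, are the standard coherent states associated with an orthonormal basis $\{e_n\}_{n\ge 0}$ of $\mathcal H$ and the corresponding annihilation operator $c$. Then: (1) $\langle \eta(z),\xi(z)\rangle=1$ for all $z\in\mathbb C$. (2) For all $f,g\in\mathcal H$, $$\langle f,g\rangle=\frac1\pi\int_{\mathbb C}d^2z\,\langle f,\eta(z)\rangle\,\langle \xi(z),g\rangle .$$ (3) Suppose there is a dense subspace $\mathcal D$ of $\mathcal H$ that is contained in the domains of $c$ and $c^\dagger$, is invariant under each of $T,\,T^\dagger,\,T^{-1},\,(T^{-1})^\dagger,\,c,\,c^\dagger$, and satisfies $\Phi(z)\in\mathcal D$ for all $z\in\mathbb C$. Then there exist operators $a$ and $b$ on $\mathcal H$ such that $\mathcal D$ is contained in the domains of $a,b,a^\dagger,b^\dagger$ and is invariant under each of these operators, such that $$a\,b\,f-b\,a\,f=f\qquad\text{for all } f\in\mathcal D,$$ and such that $$a\,\eta(z)=z\,\eta(z),\qquad b^\dagger\,\xi(z)=z\,\xi(z)\qquad\text{for all } z\in\mathbb C .$$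
   Context: Conventions: $\langle\cdot,\cdot\rangle$ is the inner product of $\mathcal H$, linear in the second argument; $X^\dagger$ is the Hilbert space adjoint of $X$; $d^2z$ is Lebesgue measure on $\mathbb C\cong\mathbb R^2$. Annihilation operator: given an orthonormal basis $\{e_n\}_{n\ge0}$ of $\mathcal H$, $c$ is the (closed) operator with domain $\{f:\sum_n n|\langle e_n,f\rangle|^2<\infty\}$ determined by $c\,e_n=\sqrt n\,e_{n-1}$ (with $e_{-1}:=0$). Its adjoint $c^\dagger$ has the same domain and satisfies $c^\dagger e_n=\sqrt{n+1}\,e_{n+1}$. Standard coherent states: for $z\in\mathbb C$, $$\Phi(z)=e^{-|z|^2/2}\sum_{k=0}^\infty\frac{z^k}{\sqrt{k!}}\,e_k .$$ Riesz bicoherent states (RBCS): for $\mathcal E\subseteq\mathbb C$, a pair of families of vectors $(\eta(z),\xi(z))$, $z\in\mathcal E$, is called RBCS if there exist standard coherent states $\Phi(z)$, $z\in\mathcal E$, and a bounded operator $T$ with bounded inverse (independent of $z$) such that $\eta(z)=T\Phi(z)$ and $\xi(z)=(T^{-1})^\dagger\Phi(z)$ for all $z\in\mathcal E$. Here $\mathcal E=\mathbb C$. *)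

(* Defs.v *)
From HB Require Import structures.
From mathcomp Require Export all_boot all_order all_algebra.
From mathcomp Require Export sesquilinear.
From mathcomp Require Export all_classical all_reals all_analysis.
From mathcomp Require Export complex.

Export Order.TTheory GRing.Theory Num.Theory.
Export numFieldNormedType.Exports.

#[export] Set Implicit Arguments.
#[export] Unset Strict Implicit.
#[export] Unset Printing Implicit Defensive.

Local Open Scope classical_set_scope.
Local Open Scope ring_scope.
Local Open Scope complex_scope.

(* The form [dotp] is linear in its first argument; see [ip]. *)
HB.mixin Record isHilbert (R : realType) H & CompleteNormedModule R[i] H := {
  dotp : {dot H for (@Num.conj R[i])} ;
  dotp_norm : forall f : H, (dotp : H -> H -> R[i]) f f = `|f| ^+ 2
}.

#[short(type="hilbertType")]
HB.structure Definition Hilbert (R : realType) :=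
  {H of CompleteNormedModule R[i] H & isHilbert R H}.

(* The arguments are swapped so that the inner product is linear in the second
   one. *)
Definition ip (R : realType) (H : hilbertType R) (f g : H) : R[i] := dotp g f.

Notation "⟨ f , g ⟩" := (ip f g)
  (at level 0, f at level 99, g at level 99, format "⟨ f ,  g ⟩") : ring_scope.

(* A space with such a basis is separable and infinite-dimensional. *)
Definition orthonormal_basis (R : realType) (H : hilbertType R) (e : nat -> H) :=
  (forall m n, ⟨e m, e n⟩ = (m == n)%:R) /\
  (forall f, series (fun n => ⟨e n, f⟩ *: e n) @ \oo --> f).

Definition subspace (R : realType) (H : hilbertType R) (D : set H) :=
  D 0 /\ (forall (a : R[i]) f g, D f -> D g -> D (a *: f + g)).

(* Possibly unbounded operators; the values of [op_fun A] outside [op_dom A] are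
   irrelevant. *)
Record operator (R : realType) (H : hilbertType R) := Operator {
  op_dom : set H ;
  op_fun :> H -> H
}.

Definition linear_operator (R : realType) (H : hilbertType R)
    (A : operator H) :=
  subspace (op_dom A) /\
  (forall (a : R[i]) f g, op_dom A f -> op_dom A g ->
     A (a *: f + g) = a *: A f + A g).

Definition closed_operator (R : realType) (H : hilbertType R)
    (A : operator H) :=
  closed [set p : H * H | op_dom A p.1 /\ p.2 = A p.1].

(* The usual adjoint when [op_dom A] is dense: [h] is then unique. *)
Definition adjoint (R : realType) (H : hilbertType R) (A : operator H) :
    operator H :=
  let is_adj g h := forall f, op_dom A f -> ⟨g, A f⟩ = ⟨h, f⟩ in
  Operator [set g | exists h, is_adj g h]
           (fun g => xget 0 [set h | is_adj g h]).

Definition total_operator (R : realType) (H : hilbertType R) (T : H -> H) :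
    operator H := Operator setT T.

Definition bounded_operator (R : realType) (H : hilbertType R)
    (T : {linear H -> H}) :=
  exists M : R[i], forall f, `|T f| <= M * `|f|.

(* For bounded [T] the adjoint is defined everywhere. *)
Definition badjoint (R : realType) (H : hilbertType R) (T : H -> H) : H -> H :=
  adjoint (total_operator T).

(* The complex modulus, with values in [R] and not in [R[i]]. *)
Definition cabs (R : realType) (z : R[i]) : R := ComplexField.Normc.normc z.

Definition annihilation_operator (R : realType) (H : hilbertType R)
    (e : nat -> H) (c : operator H) :=
  [/\ linear_operator c,
      closed_operator c,
      op_dom c =
        [set f | cvgn (series (fun n => n%:R * cabs ⟨e n, f⟩ ^+ 2 : R))] &
      forall n, c (e n) =
        if n is m.+1 then (Num.sqrt n%:R : R)%:C *: e m else 0].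

Definition coherent_state (R : realType) (H : hilbertType R) (e : nat -> H)
    (z : R[i]) : H :=
  (expR (- (cabs z ^+ 2 / 2)))%:C *:
    limn (series (fun k => (z ^+ k / (Num.sqrt k`!%:R : R)%:C) *: e k)).

(* Lebesgue measure on R * R, identified with R[i] by (x, y) |-> x +i* y *)
Definition lebesgue2 (R : realType) :
    {measure set (measurableTypeR R * measurableTypeR R) -> \bar R} :=
  (@lebesgue_measure R \x @lebesgue_measure R)%E.

Definition cintegrable (R : realType) (h : R[i] -> R[i]) :=
  (@lebesgue2 R).-integrable setT
    (EFin \o (fun p : R * R => complex.Re (h (p.1 +i* p.2)))) /\
  (@lebesgue2 R).-integrable setT
    (EFin \o (fun p : R * R => complex.Im (h (p.1 +i* p.2)))).

Definition cintegral (R : realType) (h : R[i] -> R[i]) : R[i] :=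
  Rintegral (@lebesgue2 R) setT (fun p => complex.Re (h (p.1 +i* p.2))) +i*
  Rintegral (@lebesgue2 R) setT (fun p => complex.Im (h (p.1 +i* p.2))).

Definition stable_under (R : realType) (H : hilbertType R) (D : set H)
    (A : operator H) :=
  D `<=` op_dom A /\ (A @` D `<=` D).

(* Main.v *)
(* On an orthonormal basis everything is read off on coefficients. The n-th coefficient of
   [c f] is [sqrt (n+1)] times the (n+1)-st one of [f] (apply closedness of [c] to the partial
   sums), whence the commutation relation and [c Phi(z) = z Phi(z)]; then [a = T c T^-1] and
   [b = T c^dagger T^-1], whose adjoints on [D] are [T^-dagger c^dagger T^dagger] and
   [T^-dagger c T^dagger].
   For the resolution of the identity, moving [T] across the inner product and polarizing leave
   [int |<Phi(z), f>|^2 d^2z = pi |f|^2]. Gaussian integration by parts gives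
   [int z^*^j z^k e^(-|z|^2) d^2z = pi k! delta_jk], i.e. the formula for finite combinations
   of the basis. Fatou's lemma then yields [<=] for every [f], and
   [|v|^2 <= (1 + eps) |u|^2 + (1 + 1/eps) |u - v|^2], applied to [f] and its partial sums,
   yields [>=]. *)
Require Import Defs.
From mathcomp Require Import measurable_realfun.
From mathcomp Require Import ring lra.

Local Open Scope classical_set_scope.
Local Open Scope ring_scope.
Local Open Scope complex_scope.

(** * Real-valued norms and moduli *)

Section RealNorm.
Variable R : realType.
Local Notation C := R[i].

(** The norm of a module over [C] takes values in [C]; its real part gives access to the order and
    the squeezing arguments of real sequences. *)
Definition rnorm (V : normedModType C) (v : V) : R := complex.Re `|v|.

Lemma cabsE (z : C) : `|z| = (cabs z)%:C.
Proof. by rewrite normc_def; case: z. Qed.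

Lemma rnormE (V : normedModType C) (v : V) : `|v| = (rnorm v)%:C.
Proof. by rewrite /rnorm RRe_real// normr_real. Qed.

Lemma rnorm_ge0 (V : normedModType C) (v : V) : 0 <= rnorm v.
Proof. by rewrite -ler0c -rnormE. Qed.

Lemma cabs_ge0 (z : C) : 0 <= cabs z.
Proof. by rewrite -ler0c -cabsE. Qed.

Lemma rnorm_eq0 (V : normedModType C) (v : V) : rnorm v = 0 -> v = 0.
Proof. by move=> v0; apply/normr0_eq0; rewrite rnormE v0. Qed.

(** A positive [eps] of [C] is real, so the epsilon conditions in [C] and in [R] agree. *)
Lemma cvg_rnorm (V : normedModType C) (u : nat -> V) (l : V) :
  (u @ \oo --> l) <-> ((fun n => rnorm (l - u n)) @ \oo --> (0 : R)).
Proof.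
rewrite !cvgrPdist_lt; split=> h eps.
  move=> eps0; have /h : 0 < eps%:C by rewrite ltcR.
  apply: filterS => n; rewrite rnormE ltcR sub0r normrN ger0_norm//.
  exact: rnorm_ge0.
move=> eps0; have epsE : eps = (complex.Re eps)%:C by rewrite RRe_real// gtr0_real.
have /h : 0 < complex.Re eps by rewrite -ltcR -epsE.
apply: filterS => n; rewrite rnormE sub0r normrN ger0_norm ?rnorm_ge0//.
by rewrite {2}epsE ltcR.
Qed.

Lemma cvg_Re (u : nat -> C^o) (l : C^o) : u @ \oo --> l ->
  (fun n => complex.Re (u n)) @ \oo --> complex.Re l.
Proof.
rewrite !cvgrPdist_lt => h eps eps0; have /h : 0 < eps%:C by rewrite ltcR.
apply: filterS => n; rewrite -ltcR; apply: le_lt_trans.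
by rewrite /= -raddfB; exact: normc_ge_Re.
Qed.

Lemma rnorm_cvg (V : normedModType C) (u : nat -> V) (l : V) :
  u @ \oo --> l -> (fun n => rnorm (u n)) @ \oo --> rnorm l.
Proof. by move=> ul; apply: cvg_Re; apply: cvg_norm. Qed.

End RealNorm.

(** * Sesquilinearity, Cauchy-Schwarz and continuity of the inner product *)

Section InnerProduct.
Variables (R : realType) (H : hilbertType R).
Local Notation C := R[i].
Implicit Types (f g h : H) (a z : C).

Lemma ipC f g : ⟨f, g⟩ = (⟨g, f⟩)^*%C.
Proof. by rewrite /ip hermC expr0 mul1r. Qed.

Lemma ipDr f g h : ⟨f, g + h⟩ = ⟨f, g⟩ + ⟨f, h⟩.
Proof. by rewrite /ip linearDl. Qed.
Lemma ipNr f g : ⟨f, - g⟩ = - ⟨f, g⟩.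
Proof. by rewrite /ip linearNl. Qed.
Lemma ipBr f g h : ⟨f, g - h⟩ = ⟨f, g⟩ - ⟨f, h⟩.
Proof. by rewrite ipDr ipNr. Qed.
Lemma ipZr a f g : ⟨f, a *: g⟩ = a * ⟨f, g⟩.
Proof. by rewrite /ip linearZl_LR. Qed.
Lemma ip0r f : ⟨f, 0⟩ = 0.
Proof. by rewrite /ip linear0l. Qed.
Lemma ip_sumr f (I : Type) (r : seq I) (P : pred I) (E : I -> H) :
  ⟨f, \sum_(i <- r | P i) E i⟩ = \sum_(i <- r | P i) ⟨f, E i⟩.
Proof. by rewrite /ip linear_sumlz. Qed.
Lemma ipDl f g h : ⟨f + g, h⟩ = ⟨f, h⟩ + ⟨g, h⟩.
Proof. by rewrite ipC ipDr rmorphD/= -!ipC. Qed.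
Lemma ipNl f g : ⟨- f, g⟩ = - ⟨f, g⟩.
Proof. by rewrite ipC ipNr rmorphN/= -!ipC. Qed.
Lemma ipBl f g h : ⟨f - g, h⟩ = ⟨f, h⟩ - ⟨g, h⟩.
Proof. by rewrite ipDl ipNl. Qed.
Lemma ipZl a f g : ⟨a *: f, g⟩ = a^*%C * ⟨f, g⟩.
Proof. by rewrite ipC ipZr rmorphM/= -!ipC. Qed.
Lemma ip0l f : ⟨0, f⟩ = 0.
Proof. by rewrite ipC ip0r rmorph0. Qed.

Lemma ipff f : ⟨f, f⟩ = (rnorm f ^+ 2)%:C.
Proof. by rewrite /ip dotp_norm rnormE rmorphXn. Qed.

Lemma cabs_conj z : cabs (z^*%C) = cabs z.
Proof. by apply: complexI; rewrite -!cabsE normcJ. Qed.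

Lemma mulr_conjc z : z * z^*%C = (cabs z ^+ 2)%:C.
Proof. by rewrite -sqr_normc cabsE rmorphXn. Qed.

(** The squared norm of [|g|^2 f - <g,f> g] equals [|g|^2 (|g|^2 |f|^2 - |<f,g>|^2)], and the
    positive factor cancels. Scaling [f] by [|g|^2] avoids a division. *)
Lemma cauchy_schwarz f g : cabs ⟨f, g⟩ <= rnorm f * rnorm g.
Proof.
have [g0|g0] := eqVneq (rnorm g) 0.
  by rewrite (rnorm_eq0 g0) ip0r /cabs Normc.normc0 mulr_ge0 ?rnorm_ge0.
have gp : 0 < rnorm g ^+ 2 by rewrite exprn_gt0// lt_neqAle eq_sym g0 rnorm_ge0.
set s := ⟨g, f⟩.
have : 0 <= rnorm (((rnorm g ^+ 2)%:C : C) *: f - s *: g) ^+ 2 by rewrite sqr_ge0.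
rewrite -ler0c -(ipff (_ - _)) ipBl !ipBr !ipZl !ipZr !ipff -/s.
have -> : ⟨f, g⟩ = s^*%C by rewrite ipC.
rewrite conjc_real.
have -> : (rnorm g ^+ 2)%:C * ((rnorm g ^+ 2)%:C * (rnorm f ^+ 2)%:C) -
    (rnorm g ^+ 2)%:C * (s * s^*%C) -
    (s^*%C * ((rnorm g ^+ 2)%:C * s) - s^*%C * (s * (rnorm g ^+ 2)%:C)) =
    (rnorm g ^+ 2)%:C * ((rnorm g ^+ 2)%:C * (rnorm f ^+ 2)%:C - s * s^*%C) :> C.
  by rewrite !rmorphXn/=; ring.
rewrite mulr_conjc -rmorphM -rmorphB -rmorphM/= ler0c pmulr_rge0// subr_ge0.
rewrite -exprMn ler_sqr ?nnegrE ?mulr_ge0 ?rnorm_ge0 ?cabs_ge0//.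
by rewrite cabs_conj [rnorm f * _]mulrC.
Qed.

Lemma ipr_cvg f (u : nat -> H) l : u @ \oo --> l ->
  (fun n => ⟨f, u n⟩ : C^o) @ \oo --> (⟨f, l⟩ : C^o).
Proof.
move=> /cvg_rnorm ul; apply/cvg_rnorm.
apply: (@squeeze_cvgr _ _ _ _ (cst 0) (fun n => rnorm f * rnorm (l - u n))).
- near=> n; rewrite rnorm_ge0/= -ipBr /rnorm cabsE; exact: cauchy_schwarz.
- exact: cvg_cst.
- by rewrite -[X in _ --> X](mulr0 (rnorm f)); apply: cvgMr.
Unshelve. all: by end_near. Qed.

(** Were [h] nonzero, some [f] of [D] would lie within [|h|] of it, and Cauchy-Schwarz would give
    [|h|^2 = <h, h - f> <= |h| |h - f| < |h|^2]. *)
Lemma dense_ip_eq0 (D : set H) h : dense D -> (forall f, D f -> ⟨h, f⟩ = 0) -> h = 0.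
Proof.
move=> dD h0; have [//|hn0] := eqVneq h 0.
have hp : 0 < `|h| by rewrite normr_gt0.
have [//||f [/= bf Df]] := dD (ball h `|h|).
- by exists h; exact: ballxx.
- exact: ball_open.
have e1 : ⟨h, h - f⟩ = (rnorm h ^+ 2)%:C by rewrite ipBr (h0 f Df) subr0 ipff.
move: bf; rewrite -ball_normE/= !rnormE ltcR => bf.
have := cauchy_schwarz h (h - f); rewrite e1 -lecR -cabsE.
rewrite ger0_norm ?ler0c ?sqr_ge0// lecR expr2 ler_pM2l; last by rewrite -ltcR -rnormE.
by rewrite leNgt bf.
Qed.

End InnerProduct.

(** * Orthonormal series *)

Section Orthonormal.
Variables (R : realType) (H : hilbertType R) (e : nat -> H).
Local Notation C := R[i].
Hypothesis eo : forall m n, ⟨e m, e n⟩ = (m == n)%:R.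

Lemma ip_e_sum (a : nat -> C) n m k :
  ⟨e k, \sum_(n <= i < m) a i *: e i⟩ = if (n <= k < m)%N then a k else 0.
Proof.
rewrite ip_sumr; case: ifPn => [knm|/negbTE knm].
  rewrite (bigD1_seq k) ?mem_index_iota ?iota_uniq//= big1 => [|i ik].
    by rewrite ipZr eo eqxx mulr1 addr0.
  by rewrite ipZr eo eq_sym (negbTE ik) mulr0.
apply: big1_seq => i /= inm; rewrite ipZr eo.
by case: eqP inm => [<-|_ _]; rewrite ?mulr0// mem_index_iota knm.
Qed.

Lemma rnorm_sum (a : nat -> C) n m :
  rnorm (\sum_(n <= i < m) a i *: e i) ^+ 2 = \sum_(n <= i < m) cabs (a i) ^+ 2.
Proof.
apply: (@complexI R); rewrite -ipff ip_sumr rmorph_sum.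
apply: eq_big_nat => i inm; rewrite ipZr ipC ip_e_sum inm/=.
by rewrite mulr_conjc.
Qed.

(** By Pythagoras the squared norm of a block of the vector series is a block of the real series, so
    the Cauchy criterion at [eps^2] there gives it at [eps] here. *)
Lemma cvg_orthonormal_series (a : nat -> C) :
  cvgn (series (fun i => cabs (a i) ^+ 2)) -> cvgn (series (fun i => a i *: e i)).
Proof.
move=> /cauchy_cvgP/cauchy_seriesP ca; apply/cauchy_cvgP/cauchy_seriesP => eps eps0.
have epsE : eps = (complex.Re eps)%:C by rewrite RRe_real// gtr0_real.
have ep : 0 < complex.Re eps by rewrite -ltcR -epsE.
have := ca _ (exprn_gt0 2 ep); apply: filterS => -[n m] /=.
rewrite -rnorm_sum ger0_norm ?sqr_ge0// rnormE epsE ltcR.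
by rewrite ltr_sqr// nnegrE ?rnorm_ge0 ?ltW.
Qed.

Lemma cvg_orthonormal_series_bounded (a : nat -> C) (M : R) :
  (forall n, \sum_(0 <= i < n) cabs (a i) ^+ 2 <= M) ->
  cvgn (series (fun i => a i *: e i)).
Proof.
move=> aM; apply: cvg_orthonormal_series; apply: nondecreasing_is_cvgn.
  by apply: nondecreasing_series => i _ _; rewrite sqr_ge0.
by exists M => _ [n _ <-]; exact: aM.
Qed.

(** The inner product is continuous, and the [k]-th coefficient of the partial sums is constant from
    rank [k.+1] on. *)
Lemma ip_e_lim (a : nat -> C) k : cvgn (series (fun i => a i *: e i)) ->
  ⟨e k, limn (series (fun i => a i *: e i))⟩ = a k.
Proof.
move=> ca; have /cvg_lim <-// := @ipr_cvg _ _ (e k) _ _ ca.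
apply: (@cvg_lim C^o) => //.
apply: cvg_near_cst; near=> n; rewrite /series/= ip_e_sum/=.
by rewrite ifT//; near: n; exists k.+1.
Unshelve. all: by end_near. Qed.

End Orthonormal.

(** * Basis expansions and adjoints of bounded operators *)

Section Basis.
Variables (R : realType) (H : hilbertType R) (e : nat -> H).
Local Notation C := R[i].
Hypothesis he : orthonormal_basis e.
Let eo := he.1.
Let ec := he.2.

Lemma basis_ext f g : (forall n, ⟨e n, f⟩ = ⟨e n, g⟩) -> f = g.
Proof.
move=> fg; have := @ec f; have -> : (fun n => ⟨e n, f⟩ *: e n) = (fun n => ⟨e n, g⟩ *: e n).
  by apply/funext => n; rewrite fg.
move=> fl; exact: (cvg_unique _ fl (@ec g)).
Qed.

Lemma parseval f : series (fun n => cabs ⟨e n, f⟩ ^+ 2) @ \oo --> rnorm f ^+ 2.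
Proof.
have /rnorm_cvg h := @ec f.
rewrite (_ : series _ = (fun n => rnorm (series (fun n => ⟨e n, f⟩ *: e n) n) ^+ 2)).
  by rewrite expr2; apply: cvgM.
by apply/funext => n; rewrite (rnorm_sum eo).
Qed.

Lemma bounded_rnorm (T : {linear H -> H}) : bounded_operator T ->
  exists2 M : R, 0 <= M & forall f, rnorm (T f) <= M * rnorm f.
Proof.
(* The given bound is a complex number; only its real part is compared, and the maximum with [0]
   secures the sign. *)
move=> [[M M'] hM]; exists (Num.max 0 M) => [|f]; first by rewrite le_max lexx.
have := hM f; rewrite !rnormE lecE /= => /andP[_]; rewrite mulr0 subr0 => /le_trans; apply.
by rewrite ler_wpM2r ?rnorm_ge0// le_max lexx orbT.
Qed.

Lemma bounded_cvg (T : {linear H -> H}) (u : nat -> H) l : bounded_operator T ->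
  u @ \oo --> l -> (fun n => T (u n)) @ \oo --> T l.
Proof.
move=> /bounded_rnorm[M M0 hM] /cvg_rnorm ul; apply/cvg_rnorm.
apply: (@squeeze_cvgr _ _ _ _ (cst 0) (fun n => M * rnorm (l - u n))).
- by near=> n; rewrite rnorm_ge0/= -linearB.
- exact: cvg_cst.
- by rewrite -[X in _ --> X](mulr0 M); apply: cvgMr.
Unshelve. all: by end_near. Qed.

Lemma ip_series_cvg g h : (fun n => \sum_(0 <= i < n) ⟨g, e i⟩ * ⟨e i, h⟩ : C^o) @ \oo -->
   (⟨g, h⟩ : C^o).
Proof.
have := @ipr_cvg _ _ g _ _ (@ec h); apply: cvg_trans; apply: near_eq_cvg; near=> n.
by rewrite /series/= ip_sumr; apply: eq_bigr => i _; rewrite ipZr mulrC.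
Unshelve. all: by end_near. Qed.

(* Riesz representation: the Fourier coefficients of the representing vector are read off on [e]. *)
Lemma badjointP (T : {linear H -> H}) : bounded_operator T ->
  forall g f, ⟨badjoint T g, f⟩ = ⟨g, T f⟩.
Proof.
move=> hT g f; have [M M0 hM] := bounded_rnorm hT.
(* These have to be the Fourier coefficients of the representing vector. *)
pose a n := (⟨g, T (e n)⟩)^*%C.
have ca : cvgn (series (fun i => a i *: e i)).
  apply: (@cvg_orthonormal_series_bounded _ _ _ eo _ ((rnorm g * M) ^+ 2)) => n.
  rewrite -(rnorm_sum eo); set v := \sum_(_ <= _ < _) _.
  (* With these coefficients [<g, T v> = |v|^2] for a partial sum [v], so Cauchy-Schwarz and the
     bound on [T] give [|v| <= |g| M], uniformly in [n]. *)
  have vE : ⟨g, T v⟩ = (rnorm v ^+ 2)%:C.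
    rewrite /v linear_sum ip_sumr rnorm_sum// rmorph_sum; apply: eq_bigr => i _.
    by rewrite linearZ/= ipZr -mulr_conjc conjcK.
  have := cauchy_schwarz g (T v); rewrite vE -lecR -cabsE.
  rewrite ger0_norm ?ler0c ?sqr_ge0// lecR => /le_trans/(_ (ler_wpM2l (rnorm_ge0 g) (hM v))).
  have [->|v0] := eqVneq (rnorm v) 0; first by rewrite expr0n sqr_ge0.
  have vp : 0 < rnorm v by rewrite lt_neqAle eq_sym v0 rnorm_ge0.
  rewrite mulrA expr2 ler_pM2r// => vM.
  by rewrite -expr2 ler_sqr ?nnegrE ?mulr_ge0 ?rnorm_ge0.
have : exists h, forall f, ⟨g, T f⟩ = ⟨h, f⟩.
  exists (limn (series (fun i => a i *: e i))) => k.
  (* Both sides are limits of the same partial sums. *)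
  apply: (@cvg_unique C^o _
    ((fun n => ⟨g, T (series (fun i => ⟨e i, k⟩ *: e i) n)⟩ : C^o) @ \oo)) => //.
    by apply: ipr_cvg; apply: bounded_cvg.
  have := @ip_series_cvg (limn (series (fun i => a i *: e i))) k.
  apply: cvg_trans; apply: near_eq_cvg; near=> n.
  rewrite /series/= linear_sum ip_sumr; apply: eq_bigr => i _.
  by rewrite linearZ/= ipZr mulrC (ipC (limn _)) (ip_e_lim eo)// /a conjcK.
move=> [h hE].
(* Existence ensures that the choice in [adjoint] returns a representing vector and not the default
   [0]. *)
have /xgetPex : exists h, [set h | forall f, setT f -> ⟨g, T f⟩ = ⟨h, f⟩] h by exists h.
by move=> /(_ 0)/(_ f I) ->.
Unshelve. all: by end_near. Qed.

End Basis.

(** * Coefficients and norm of coherent states *)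

Section CoherentStates.
Variables (R : realType) (H : hilbertType R) (e : nat -> H).
Local Notation C := R[i].
Hypothesis he : orthonormal_basis e.
Let eo := he.1.

Definition coherent_coef (z : C) (k : nat) : C := z ^+ k / (Num.sqrt k`!%:R : R)%:C.

(** Both the convergence of the coherent series and its norm are read off from the exponential
    series at [|z|^2]. *)
Lemma cabs_coherent_coef z k : cabs (coherent_coef z k) ^+ 2 = exp_coeff (cabs z ^+ 2) k.
Proof.
rewrite /coherent_coef /cabs Normc.normcM Normc.normcV exprMn exprVn /exp_coeff/=.
rewrite expr0n addr0 sqrtr_sqr ger0_norm ?sqrtr_ge0// sqr_sqrtr ?ler0n//.
congr (_ / _); rewrite -exprM mulnC exprM; congr (_ ^+ _).
by apply: complexI; rewrite -!/(cabs _) -cabsE normrX cabsE rmorphXn.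
Qed.

Lemma cvg_coherent_series z : cvgn (series (fun k => coherent_coef z k *: e k)).
Proof.
apply: cvg_orthonormal_series => //; under eq_fun do rewrite cabs_coherent_coef.
exact: is_cvg_series_exp_coeff.
Qed.

Lemma ip_e_coherent z k : ⟨e k, coherent_state e z⟩ =
  (expR (- (cabs z ^+ 2 / 2)))%:C * coherent_coef z k.
Proof. by rewrite /coherent_state ipZr (ip_e_lim eo)//; exact: cvg_coherent_series. Qed.

(** Parseval turns the squared norm into [e^(-|z|^2)] times the exponential series at [|z|^2]. *)
Lemma rnorm_coherent z : rnorm (coherent_state e z) = 1.
Proof.
apply/eqP; rewrite -sqrp_eq1 ?rnorm_ge0//; apply/eqP.
have := @parseval _ _ _ he (coherent_state e z).
under eq_fun do rewrite ip_e_coherent.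
have -> : (fun n => cabs ((expR (- (cabs z ^+ 2 / 2)))%:C * coherent_coef z n) ^+ 2) =
   expR (- cabs z ^+ 2) *: exp_coeff (cabs z ^+ 2).
  apply/funext => n; rewrite /cabs Normc.normcM -!/(cabs _) exprMn cabs_coherent_coef.
  rewrite /cabs/= expr0n addr0 sqrtr_sqr ger0_norm ?expR_ge0// -expRM_natl.
  by congr (expR _ * _); field.
move=> /cvg_lim <- //.
rewrite lim_seriesZ; last exact: is_cvg_series_exp_coeff.
by rewrite -/(expR _) /GRing.scale/= expRN mulVf// gt_eqF// expR_gt0.
Qed.

End CoherentStates.

(** * Unbounded operators: adjoints, linearity, closedness *)

Section Operators.
Variables (R : realType) (H : hilbertType R).
Local Notation C := R[i].
Implicit Types (A : operator H) (f g h : H).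

Lemma adjointP A f g : op_dom (adjoint A) g -> op_dom A f ->
  ⟨g, A f⟩ = ⟨adjoint A g, f⟩.
Proof.
move=> gA fA; have /= /(_ f fA) := @xgetPex _ (0 : H)
  [set h | forall f, op_dom A f -> ⟨g, A f⟩ = ⟨h, f⟩] gA.
exact.
Qed.

(** Density makes the representing vector unique, so the one chosen by [adjoint] is [h]. This is how
    adjoints get computed. *)
Lemma adjoint_eq A g h : dense (op_dom A) ->
  (forall f, op_dom A f -> ⟨g, A f⟩ = ⟨h, f⟩) ->
  op_dom (adjoint A) g /\ adjoint A g = h.
Proof.
move=> dA gh; have gA : op_dom (adjoint A) g by exists h.
split=> //; apply/subr0_eq/(dense_ip_eq0 dA) => f fA.
by rewrite ipBl -adjointP// gh// subrr.
Qed.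

Lemma adjoint_linear A : dense (op_dom A) -> linear_operator (adjoint A).
Proof.
move=> dA.
have lin (a : C) f g : op_dom (adjoint A) f -> op_dom (adjoint A) g ->
    op_dom (adjoint A) (a *: f + g) /\
    adjoint A (a *: f + g) = a *: adjoint A f + adjoint A g.
  move=> fA gA; apply: adjoint_eq => // h hA.
  by rewrite !ipDl !ipZl !adjointP.
split; last by move=> a f g fA gA; have [] := lin a f g fA gA.
split; last by move=> a f g fA gA; have [] := lin a f g fA gA.
by exists 0 => f _; rewrite !ip0l.
Qed.

Lemma denseW (D E : set H) : D `<=` E -> dense D -> dense E.
Proof.
move=> DE dD O O0 oO; have [x [Ox Dx]] := dD O O0 oO.
by exists x; split=> //; exact: DE.
Qed.

Lemma linear_operator0 A : linear_operator A -> op_dom A 0 /\ A 0 = 0.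
Proof.
move=> [[A0 _] AL]; split=> //.
by have := AL (-1) 0 0 A0 A0; rewrite scaler0 addr0 scaleN1r addNr.
Qed.

Lemma linear_operator_sum A (a : nat -> C) (u : nat -> H) n : linear_operator A ->
  (forall i, op_dom A (u i)) ->
  op_dom A (\sum_(0 <= i < n) a i *: u i) /\
  A (\sum_(0 <= i < n) a i *: u i) = \sum_(0 <= i < n) a i *: A (u i).
Proof.
move=> lA Au; have [A0 AE0] := linear_operator0 lA; have [[_ AS] AL] := lA.
elim: n => [|n [ihd ih]]; first by rewrite !big_nil.
rewrite !big_nat_recr//= [X in op_dom A X]addrC [X in A X]addrC; split; first exact: AS.
by rewrite AL// ih addrC.
Qed.

Lemma closed_operator_cvg A (u : nat -> H) f g : closed_operator A ->
  (forall n, op_dom A (u n)) -> u @ \oo --> f -> (fun n => A (u n)) @ \oo --> g ->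
  op_dom A f /\ A f = g.
Proof.
move=> cA uA uf Aug.
have [] := @closed_cvg _ _ \oo _ (fun n => (u n, A (u n)))
  [set p : H * H | op_dom A p.1 /\ p.2 = A p.1] cA _ (f, g) _ => //.
- by apply: nearW => n /=.
- exact: cvg_pair.
Qed.

End Operators.

(** * Annihilation and creation on coefficients *)

Section Annihilation.
Variables (R : realType) (H : hilbertType R) (e : nat -> H) (c : operator H).
Local Notation C := R[i].
Hypotheses (he : orthonormal_basis e) (hc : annihilation_operator e c).
Let eo := he.1.

(** The series that defines the domain is constant from rank [n.+1] on. *)
Lemma annihilation_dom_e n : op_dom c (e n).
Proof.
have [_ _ -> _] := hc; rewrite /mkset.
apply: (is_cvg_near_cst (series (fun k => k%:R * cabs ⟨e k, e n⟩ ^+ 2 : R) n.+1)).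
exists n.+1 => // m /= nm.
rewrite /series/= [LHS](big_cat_nat (n:=n.+1))//=.
rewrite -[RHS]addr0; congr (_ + _); rewrite big_nat_cond big1// => i /andP[/andP[ni _] _].
by rewrite eo gtn_eqF// /cabs Normc.normc0 expr0n mulr0.
Qed.

(** Since [c] kills [e 0], a sum of [n.+1] terms becomes one of [n] terms with indices lowered by
    one. *)
Lemma annihilation_sum (a : nat -> C) n :
  op_dom c (\sum_(0 <= i < n.+1) a i *: e i) /\
  c (\sum_(0 <= i < n.+1) a i *: e i) =
    \sum_(0 <= i < n) (a i.+1 * (Num.sqrt i.+1%:R : R)%:C) *: e i.
Proof.
have [lc _ _ ce] := hc.
have [? ->] := linear_operator_sum a n.+1 lc annihilation_dom_e; split=> //.
rewrite big_nat_recl// ce scaler0 add0r; apply: eq_bigr => i _.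
by rewrite ce scalerA.
Qed.

(** Closedness of [c] carries the formula for partial sums to the limit, giving membership in the
    domain along with the value. *)
Lemma annihilation_series (a : nat -> C) f g :
  series (fun i => a i *: e i) @ \oo --> f ->
  series (fun i => (a i.+1 * (Num.sqrt i.+1%:R : R)%:C) *: e i) @ \oo --> g ->
  op_dom c f /\ c f = g.
Proof.
move=> af ag; have [_ cc _ _] := hc.
apply: (@closed_operator_cvg _ _ _ (fun n => series (fun i => a i *: e i) n.+1)) => //.
- by move=> n; have [] := annihilation_sum a n.
- by rewrite cvg_shiftS.
- rewrite (_ : (fun n => _) = series (fun i => (a i.+1 * (Num.sqrt i.+1%:R : R)%:C) *: e i))//.
  by apply/funext => n; have [] := annihilation_sum a n.
Qed.

(** The coefficients satisfy [a_(k+1) sqrt (k+1) = z a_k], so lowering the series multiplies it by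
    [z]. *)
Lemma annihilation_coherent z :
  op_dom c (coherent_state e z) /\ c (coherent_state e z) = z *: coherent_state e z.
Proof.
have [lc _ _ _] := hc; have [[_ cS] cL] := lc; have [c0 cE0] := linear_operator0 lc.
set v := limn (series (fun k => coherent_coef z k *: e k)).
have sv : series (fun k => coherent_coef z k *: e k) @ \oo --> v.
  exact: cvg_coherent_series.
have [vc cv] : op_dom c v /\ c v = z *: v.
  apply: (annihilation_series sv).
  rewrite (_ : series _ = z \*: series (fun k => coherent_coef z k *: e k)).
    exact: cvgZl_tmp.
  apply/funext => n; rewrite /series/= scaler_sumr; apply: eq_bigr => i _.
  rewrite scalerA; congr (_ *: _); rewrite /coherent_coef factS natrM sqrtrM ?ler0n//.
  rewrite exprS rmorphM/= invfM; rewrite -!mulrA; congr (_ * (_ * _)).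
  rewrite mulrCA mulVf ?mulr1//.
  by rewrite (inj_eq (@complexI R)) gt_eqF// sqrtr_gt0 ltr0n.
rewrite /coherent_state -/v.
set a := (expR _)%:C; split; first by rewrite -[_ *: _]addr0; apply: cS.
by rewrite -[X in c X]addr0 cL// cE0 addr0 cv scalerA mulrC -scalerA.
Qed.

(** Membership in the domain is square summability of the lowered coefficients, so
    [annihilation_series] applies to the expansion of [f]. *)
Lemma ip_e_annihilation f n : op_dom c f ->
  ⟨e n, c f⟩ = (Num.sqrt n.+1%:R : R)%:C * ⟨e n.+1, f⟩.
Proof.
move=> fc.
have ca : cvgn (series (fun i => (⟨e i.+1, f⟩ * (Num.sqrt i.+1%:R : R)%:C) *: e i)).
  apply: cvg_orthonormal_series => //.
  have : cvgn (series (fun n => n%:R * cabs ⟨e n, f⟩ ^+ 2 : R)).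
    by have [_ _ domc _] := hc; move: fc; rewrite domc.
  move=> /cvg_ex[l hl]; apply/cvg_ex; exists l.
  (* The term of index [0] carries the factor [0], so shifting by one keeps the limit. *)
  move: hl; rewrite -cvg_shiftS; apply: cvg_trans; apply: near_eq_cvg; near=> m.
  rewrite /series/= big_nat_recl//= mul0r add0r; apply: eq_bigr => i _.
  rewrite /cabs Normc.normcM exprMn mulrC; congr (_ * _).
  by rewrite /= expr0n addr0 sqrtr_sqr ger0_norm ?sqrtr_ge0// sqr_sqrtr ?ler0n.
have [_ ->] := annihilation_series (@he.2 f) ca.
by rewrite (ip_e_lim eo)// mulrC.
Unshelve. all: by end_near. Qed.

Lemma ip_e_creation f n : op_dom (adjoint c) f ->
  ⟨e n, adjoint c f⟩ = if n is m.+1 then (Num.sqrt n%:R : R)%:C * ⟨e m, f⟩ else 0.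
Proof.
move=> fc; have [_ _ _ ce] := hc; have ed := annihilation_dom_e n.
rewrite ipC -(adjointP fc ed) ce; case: n {ed} => [|n]; first by rewrite ip0r rmorph0.
by rewrite ipZr rmorphM/= -ipC oppr0.
Qed.

(** On the [n]-th coefficient the two products act as [n + 1] and [n]. Index [0] is treated apart:
    the second product has coefficient [0] there. *)
Lemma annihilation_commutator f : op_dom c f -> op_dom (adjoint c) f ->
  op_dom c (adjoint c f) -> op_dom (adjoint c) (c f) ->
  c (adjoint c f) - adjoint c (c f) = f.
Proof.
move=> fc fa fac fca; apply: (basis_ext he) => n.
rewrite ipBr ip_e_annihilation// !ip_e_creation// mulrA -rmorphM/= -expr2.
rewrite sqr_sqrtr ?ler0n//; case: n => [|n]; first by rewrite subr0 mul1r.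
rewrite ip_e_annihilation// mulrA -rmorphM/= -expr2 sqr_sqrtr ?ler0n//.
by rewrite -mulrBl -rmorphB/= -natrB// subSnn mul1r.
Qed.

End Annihilation.

(** * Gaussian moments on the line *)

Section GaussianMoments.
Variable R : realType.
Local Notation mu := (@lebesgue_measure R).
Local Notation gauss_fun := (@gauss_integral.gauss_fun R).

(** The fundamental theorem on [[-n, n]] gives [F n - F (-n)], which tends to [0]; dominated
    convergence with majorant [|f|] identifies the limit with the integral over the line. *)
Lemma Rintegral_derive_eq0 (f F : R -> R) : continuous f ->
  (forall x, is_derive x (1 : R) F (f x)) -> mu.-integrable setT (EFin \o f) ->
  (fun n => F n%:R) @ \oo --> (0 : R) -> (fun n => F (- n%:R)) @ \oo --> (0 : R) ->
  Rintegral mu setT f = 0.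
Proof.
move=> cf dF intf F0 FN0.
pose g : measurableTypeR R -> \bar R := EFin \o f.
pose f_ n : measurableTypeR R -> \bar R := g \_ `[- n%:R, n%:R].
have mf : measurable_fun setT g by exact: measurable_int intf.
have mf_ n : measurable_fun setT (f_ n).
  by apply: (measurable_restrictT g _).1 => //; exact: measurable_funTS.
have cF : continuous F.
  by move=> x; apply: differentiable_continuous; apply/derivable1_diffP; exact: ex_derive.
have [] := @dominated_convergence _ _ R mu setT measurableT f_ g (abse \o g) mf_ mf.
- apply: aeW => x _; apply: cvg_near_cst; near=> n.
  rewrite /f_ patchE ifT// inE/= in_itv/= -ler_norml.
  by near: n; exact: nbhs_infty_ger.
- exact: integrable_abse.
- apply: aeW => x n _; rewrite /f_ patchE; case: ifPn => //= _.
  by rewrite lee_fin normr0.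
move=> _ _ /=.
have -> : (fun n => \int[mu]_x f_ n x)%E = (fun n => (F n%:R - F (- n%:R))%:E).
  apply/funext => n; rewrite -integral_mkcond.
  (* The fundamental theorem is applied to nondegenerate intervals; [n = 0] leaves a single
     point. *)
  have [->|n0] := eqVneq n 0%N.
    by rewrite oppr0 set_itv1 integral_set1 subrr.
  rewrite (@continuous_FTC2 _ f F) ?EFinB//.
  - by rewrite gtrN// ltr0n lt0n.
  - by apply: continuous_subspaceT.
  - split; [by move=> x _; exact: ex_derive|..].
      by apply: cvg_at_right_filter; exact: cF.
    by apply: cvg_at_left_filter; exact: cF.
  - by move=> x _; rewrite derive1E derive_val.
move=> h; have : (fun n => F n%:R - F (- n%:R)) @ \oo --> (0 : R).
  by rewrite -[X in _ --> X](subr0 0); exact: cvgB.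
move=> h0; have /cvg_unique : (fun n => (F n%:R - F (- n%:R))%:E) @ \oo --> 0%:E.
  by apply: cvg_EFin => //; exact: nearW.
by move=> /(_ (@ereal_hausdorff R) _ h) /= E; rewrite /Rintegral -E.
Unshelve. all: by end_near. Qed.

Definition gauss_monomial n (x : R) := x ^+ n * gauss_fun x.

(** For [n = 0] the truncated predecessor is multiplied by [0]. *)
Lemma is_derive_gauss_monomial n x : is_derive x (1 : R) (gauss_monomial n)
  (n%:R * gauss_monomial n.-1 x - 2 * gauss_monomial n.+1 x).
Proof.
have d := is_deriveM (is_deriveX n (is_derive_id x (1 : R)))
  (is_derive1_comp (is_derive_expR _) (is_deriveN (is_deriveX 2 (is_derive_id x (1 : R))))).
have gE : gauss_monomial n = (id ^+ n) * (expR \o (- (id ^+ 2))).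
  by apply/funext => y; rewrite /gauss_monomial /gauss_integral.gauss_fun !fctE.
rewrite gE; apply: (is_derive_eq d).
rewrite /gauss_monomial /gauss_integral.gauss_fun /GRing.scale/= !fctE/= expr1 [x ^+ n.+1]exprS.
ring.
Qed.

Lemma continuous_gauss_monomial n : continuous (gauss_monomial n).
Proof.
move=> x; apply: differentiable_continuous; apply/derivable1_diffP.
by have := is_derive_gauss_monomial n x => h; exact: ex_derive.
Qed.

(** For positive [k], raise [t / k <= 1 + t / k <= e^(t/k)] to the power [k]. *)
Lemma expr_le_expR (t : R) k : 0 <= t -> t ^+ k <= k%:R ^+ k * expR t.
Proof.
case: k => [|k] t0; first by rewrite !expr0 mul1r -[leLHS]expR0 ler_expR.
have k0 : (0 : R) < k.+1%:R by rewrite ltr0n.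
have -> : expR t = expR (t / k.+1%:R) ^+ k.+1.
  by rewrite -expRM_natl mulrC divfK// gt_eqF.
rewrite -exprMn lerXn2r ?nnegrE ?mulr_ge0 ?expR_ge0 ?(ltW k0)//.
rewrite mulrC -ler_pdivrMr//; apply: le_trans (expR_ge1Dx _).
by rewrite lerDr.
Qed.

(** Half of the Gaussian absorbs the monomial: with [t = x^2 / 2], [|x^n| <= 1 + x^(2n)] and
    [x^(2n) = (2t)^n <= (2n)^n e^t], whence the constant [1 + (2n)^n]. *)
Lemma gauss_monomial_le n : exists2 M : R, 0 <= M &
  forall x, `|gauss_monomial n x| <= M * expR (- (x ^+ 2 / 2)).
Proof.
have M0 : (0 : R) <= 1 + (2 * n%:R) ^+ n by rewrite addr_ge0// exprn_ge0// mulr_ge0.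
exists (1 + (2 * n%:R) ^+ n) => // x.
rewrite /gauss_monomial /gauss_integral.gauss_fun normrM [`|expR _|]ger0_norm ?expR_ge0//.
have -> : - x ^+ 2 = x ^+ 2 / 2 *- 1 + - (x ^+ 2 / 2) by field.
rewrite expRD mulrA ler_wpM2r ?expR_ge0//.
rewrite mulr1n expRN ler_pdivrMr ?expR_gt0//.
have t0 : 0 <= x ^+ 2 / 2 by rewrite divr_ge0 ?sqr_ge0.
have h : x ^+ (2 * n) <= (2 * n%:R) ^+ n * expR (x ^+ 2 / 2).
  have xE : x ^+ 2 = 2 * (x ^+ 2 / 2) by field.
  rewrite exprM [X in X ^+ n <= _]xE; move: (x ^+ 2 / 2) t0 => t t0.
  rewrite exprMn [X in _ <= X * _]exprMn -mulrA ler_wpM2l ?exprn_ge0//.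
  exact: expr_le_expR.
have h1 : 1 <= expR (x ^+ 2 / 2) by rewrite -[leLHS]expR0 ler_expR.
have : `|x ^+ n| <= 1 + x ^+ (2 * n).
  rewrite mulnC exprM -(real_normK (num_real (x ^+ n))).
  set y := `|_|; have : 0 <= y by exact: normr_ge0.
  nra.
by nra.
Qed.

Lemma integrable_gauss_monomial n : mu.-integrable setT (EFin \o gauss_monomial n).
Proof.
have [M M0 hM] := gauss_monomial_le n.
(* The majorant [M e^(-x^2/2)] is [M] times the standard normal density divided by its peak. *)
have i1 : mu.-integrable setT (fun x =>
    M%:E * ((normal_peak 1)^-1%:E * (normal_pdf (0 : R) 1 x)%:E))%E.
  by do 2 apply: integrableZl => //; exact: integrable_normal_pdf.
apply: le_integrable i1 => //.
  by apply/measurable_EFinP; apply: continuous_measurable_fun; exact: continuous_gauss_monomial.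
move=> x _; rewrite normal_pdfE ?oner_neq0// /normal_fun subr0.
rewrite -!EFinM /= lee_fin mulKf ?gt_eqF ?normal_peak_gt0 ?oner_neq0//.
by rewrite expr1n -[1 *+ 2]/(2 : R) mulNr [leRHS]ger0_norm ?mulr_ge0 ?expR_ge0.
Qed.

(** The bound for exponent [n.+1], divided by [m], tends to [0]. The values [1] and [-1] of [s]
    serve the two ends of the line. *)
Lemma cvg_gauss_monomial n (s : R) : `|s| = 1 ->
  (fun m => gauss_monomial n (s * m%:R)) @ \oo --> (0 : R).
Proof.
move=> s1; have [M M0 hM] := gauss_monomial_le n.+1.
apply/norm_cvg0P; apply: (@squeeze_cvgr _ _ _ _ (cst 0) (fun m => M * m%:R^-1)).
- near=> m; rewrite normr_ge0/=.
  have m0 : (0 : R) < m%:R by rewrite ltr0n; near: m; exists 1%N.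
  rewrite ler_pdivlMr//; have := hM (s * m%:R).
  rewrite /gauss_monomial exprS -mulrA normrM normrM s1 mul1r.
  rewrite [`|m%:R|]ger0_norm ?ler0n// mulrC => /le_trans; apply.
  by rewrite ler_piMr// -[leRHS]expR0 ler_expR oppr_le0 divr_ge0 ?sqr_ge0.
- exact: cvg_cst.
- rewrite -[X in _ --> X](mulr0 M); apply: cvgMr.
  by apply/gtr0_cvgV0; [near=> k; rewrite ltr0n; near: k; exists 1%N|exact: cvgr_idn].
Unshelve. all: by end_near. Qed.

Definition gauss_moment n := Rintegral mu setT (gauss_monomial n).

Lemma gauss_moment0 : gauss_moment 0 = Num.sqrt pi.
Proof.
rewrite /gauss_moment /Rintegral.
under eq_integral do rewrite /= /gauss_monomial expr0 mul1r.
by rewrite gauss_integral.integralT_gauss.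
Qed.

(** The derivative of [gauss_monomial n] integrates to [0]; for [n = 0] this is the vanishing of the
    first moment. *)
Lemma gauss_momentS n : gauss_moment n.+1 = n%:R / 2 * gauss_moment n.-1.
Proof.
have : Rintegral mu setT (fun x => n%:R * gauss_monomial n.-1 x - 2 * gauss_monomial n.+1 x) = 0.
  apply: (@Rintegral_derive_eq0 _ (gauss_monomial n)).
  - move=> x; apply: cvgB; apply: cvgMr; exact: continuous_gauss_monomial.
  - exact: is_derive_gauss_monomial.
  - by apply: (integrableB _ (integrableZl _ _ (integrable_gauss_monomial _))
      (integrableZl _ _ (integrable_gauss_monomial _))).
  - by under eq_fun do rewrite -[_%:R]mul1r; apply: cvg_gauss_monomial; rewrite normr1.
  - by under eq_fun do rewrite -mulN1r; apply: cvg_gauss_monomial; rewrite normrN1.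
have iZ (a : R) k : mu.-integrable setT (EFin \o (fun x => a * gauss_monomial k x)).
  exact: (integrableZl _ _ (integrable_gauss_monomial _)).
rewrite RintegralB// !RintegralZl//; try exact: integrable_gauss_monomial.
rewrite -!/(gauss_moment _) => h; lra.
Qed.

End GaussianMoments.

(** * Tonelli and Fubini for products of one-variable functions *)

Section ProductIntegral.
Variable R : realType.
Local Notation mu := (@lebesgue_measure R).

(** By Tonelli: the inner integral of the absolute value is [|f x|] times a finite constant. *)
Lemma integrable_prod_mul (f g : R -> R) :
  mu.-integrable setT (EFin \o f) -> mu.-integrable setT (EFin \o g) ->
  (@lebesgue2 R).-integrable setT (EFin \o (fun p : R * R => f p.1 * g p.2)).
Proof.
move=> intf intg.
have mf : measurable_fun [set: measurableTypeR R] f.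
  by apply/measurable_EFinP; exact: measurable_int intf.
have mg : measurable_fun [set: measurableTypeR R] g.
  by apply/measurable_EFinP; exact: measurable_int intg.
apply/integrable12ltyP.
  apply/measurable_EFinP; apply: measurable_funM.
    by apply: measurableT_comp => //; exact: measurable_fst.
  by apply: measurableT_comp => //; exact: measurable_snd.
have gfin : (\int[mu]_y `|(g y)%:E| \is a fin_num)%E.
  by apply: integrable_fin_num => //; exact: integrable_abse intg.
rewrite (_ : (fun x => _) = (fun x => `|(f x)%:E| * (fine (\int[mu]_y `|(g y)%:E|))%:E)%E).
  rewrite integralZr//; last exact: integrable_abse intf.
  rewrite -[X in (X * _)%E]fineK -?EFinM ?ltry//.
  by apply: integrable_fin_num => //; exact: integrable_abse intf.
apply/funext => x.
under eq_integral do rewrite /= normrM EFinM.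
rewrite ge0_integralZl// ?fineK//.
by apply/measurable_EFinP; apply: measurableT_comp.
Qed.

Lemma Rintegral_prod_mul (f g : R -> R) :
  mu.-integrable setT (EFin \o f) -> mu.-integrable setT (EFin \o g) ->
  Rintegral (@lebesgue2 R) setT (fun p : R * R => f p.1 * g p.2) =
  Rintegral mu setT f * Rintegral mu setT g.
Proof.
move=> intf intg; rewrite /Rintegral -integral12_prod_meas1; last first.
  exact: integrable_prod_mul.
have -> : (fun x => \int[mu]_y (f (x, y).1 * g (x, y).2)%:E)%E =
   (fun x => (f x * Rintegral mu setT g)%:E).
  apply/funext => x; under eq_integral do rewrite /= EFinM.
  rewrite integralZl// EFinM /Rintegral fineK//.
  exact: (integrable_fin_num measurableT intg).
rewrite -!/(Rintegral _ _ _) [LHS]RintegralZr//.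
Qed.

End ProductIntegral.

(** * Linearity of the complex integral *)

Section ComplexIntegral.
Variable R : realType.
Local Notation C := R[i].
Local Notation nu := (@lebesgue2 R).
Implicit Types (h k : C -> C).

Let intD (u v : R * R -> R) : nu.-integrable setT (EFin \o u) ->
  nu.-integrable setT (EFin \o v) -> nu.-integrable setT (EFin \o (fun p => u p + v p)).
Proof. by move=> iu iv; exact: (integrableD measurableT iu iv). Qed.

Let intZ (r : R) (u : R * R -> R) : nu.-integrable setT (EFin \o u) ->
  nu.-integrable setT (EFin \o (fun p => r * u p)).
Proof. by move=> iu; exact: (integrableZl measurableT r iu). Qed.

Lemma cintegrableD h k : cintegrable h -> cintegrable k ->
  cintegrable (fun z => h z + k z).
Proof.
move=> [hr hi] [kr ki]; split.
  by under [X in _ \o X]eq_fun do rewrite raddfD/=; exact: intD.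
by under [X in _ \o X]eq_fun do rewrite raddfD/=; exact: intD.
Qed.

Lemma cintegralD h k : cintegrable h -> cintegrable k ->
  cintegral (fun z => h z + k z) = cintegral h + cintegral k.
Proof.
move=> [hr hi] [kr ki]; rewrite /cintegral.
under eq_Rintegral do rewrite raddfD/=.
under [X in _ +i* X]eq_Rintegral do rewrite raddfD/=.
by rewrite !RintegralD.
Qed.

Let ReM (a b : C) : complex.Re (a * b) =
  complex.Re a * complex.Re b + - complex.Im a * complex.Im b.
Proof. by case: a b => [a a'] [b b'] /=; rewrite mulNr. Qed.

Let ImM (a b : C) : complex.Im (a * b) =
  complex.Re a * complex.Im b + complex.Im a * complex.Re b.
Proof. by case: a b => [a a'] [b b'] /=. Qed.

Lemma cintegrableZ (a : C) h : cintegrable h -> cintegrable (fun z => a * h z).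
Proof.
move=> [hr hi]; split.
  by under [X in _ \o X]eq_fun do rewrite ReM; apply: intD; exact: intZ.
by under [X in _ \o X]eq_fun do rewrite ImM; apply: intD; exact: intZ.
Qed.

Lemma cintegralZ (a : C) h : cintegrable h ->
  cintegral (fun z => a * h z) = a * cintegral h.
Proof.
move=> [hr hi]; rewrite /cintegral.
under eq_Rintegral do rewrite ReM.
under [X in _ +i* X]eq_Rintegral do rewrite ImM.
rewrite !RintegralD//; try exact: intZ.
rewrite !RintegralZl//; case: a => a a' /=.
by rewrite mulNr.
Qed.

Lemma cintegrable0 : cintegrable (fun _ : C => 0 : C).
Proof. by split; exact: integrable0. Qed.

Lemma cintegrable_sum I (r : seq I) (P : pred I) (h : I -> C -> C) :
  (forall i, cintegrable (h i)) ->
  cintegrable (fun z => \sum_(i <- r | P i) h i z).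
Proof.
move=> hi; elim: r => [|i r ih].
  rewrite (_ : (fun z => _) = (fun=> 0)); first exact: cintegrable0.
  by apply/funext => z; rewrite big_nil.
rewrite (_ : (fun z => _) = (fun z => if P i then h i z + \sum_(j <- r | P j) h j z
  else \sum_(j <- r | P j) h j z)); last by apply/funext => z; rewrite big_cons.
by case: (P i) => //; exact: cintegrableD.
Qed.

Lemma cintegral_sum I (r : seq I) (P : pred I) (h : I -> C -> C) :
  (forall i, cintegrable (h i)) ->
  cintegral (fun z => \sum_(i <- r | P i) h i z) = \sum_(i <- r | P i) cintegral (h i).
Proof.
move=> hi; elim: r => [|i r ih].
  rewrite (_ : (fun z => _) = (fun=> 0)) ?big_nil; last by apply/funext => z; rewrite big_nil.
  rewrite /cintegral /=.
  by rewrite /Rintegral integral0.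
rewrite big_cons (_ : (fun z => _) = (fun z => if P i then h i z + \sum_(j <- r | P j) h j z
  else \sum_(j <- r | P j) h j z)); last by apply/funext => z; rewrite big_cons.
case: (P i) => //; rewrite cintegralD ?ih//; exact: cintegrable_sum.
Qed.

End ComplexIntegral.

(* [J j k a b] is the Gaussian integral of [z^* ^ j * z ^ k * x ^ a * y ^ b], where
   [z = x + i y]. *)
Lemma by_parts_recursion (F : fieldType) (J : nat -> nat -> nat -> nat -> F) (i : F) :
  (forall j k a b, J j k.+1 a b = J j k a.+1 b + i * J j k a b.+1) ->
  (forall j k a b, J j.+1 k a b = J j k a.+1 b + - i * J j k a b.+1) ->
  (forall a b, J 0 0 a.+1 b = a%:R * J 0 0 a.-1 b / 2) ->
  (forall a b, J 0 0 a b.+1 = b%:R * J 0 0 a b.-1 / 2) ->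
  forall j k a b,
  J j k a.+1 b = (a%:R * J j k a.-1 b + j%:R * J j.-1 k a b + k%:R * J j k.-1 a b) / 2 /\
  J j k a b.+1 = (b%:R * J j k a b.-1 + - i * (j%:R * J j.-1 k a b) +
                  i * (k%:R * J j k.-1 a b)) / 2.
Proof.
(* A factor [z] or its conjugate is traded for [x + i y] or [x - i y], and the hypothesis is used at
   [a.+1] and at [b.+1]; the unit gained there becomes the new unit of [k] or [j]. *)
move=> JS JSl Jx Jy; elim=> [|j ihj] k a b.
  elim: k a b => [|k ihk] a b; first by rewrite Jx Jy; split; ring.
  have [X1 Y1] := ihk a.+1 b; have [X2 Y2] := ihk a b.+1.
  split; rewrite [LHS]JS.
    (* The case splits resolve the predecessors truncated at [0], whose coefficients vanish. *)
    rewrite X1 X2; case: a {X1 X2 Y1 Y2} => [|a]; case: k {ihk} => [|k] /=;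
      by rewrite !JS; ring.
  rewrite Y1 Y2; case: b {X1 X2 Y1 Y2} => [|b]; case: k {ihk} => [|k] /=;
    by rewrite !JS; ring.
have [X1 Y1] := ihj k a.+1 b; have [X2 Y2] := ihj k a b.+1.
split; rewrite [LHS]JSl.
  rewrite X1 X2; case: a {X1 X2 Y1 Y2} => [|a]; case: j {ihj} => [|j] /=;
    by rewrite !JSl; ring.
rewrite Y1 Y2; case: b {X1 X2 Y1 Y2} => [|b]; case: j {ihj} => [|j] /=;
  by rewrite !JSl; ring.
Qed.

(** * Gaussian moments in the plane *)

Section PlanarMoments.
Variable R : realType.
Local Notation C := R[i].

(** The exponents [a] and [b] serve the induction that trades [z] and its conjugate for coordinates.
    The two Gaussian factors multiply to the weight [e^(-|z|^2)]. *)
Definition planar_monomial (j k a b : nat) (z : C) : C :=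
  z^*%C ^+ j * z ^+ k * (gauss_monomial a (complex.Re z) * gauss_monomial b (complex.Im z))%:C.

Let gmS n (x : R) : gauss_monomial n.+1 x = x * gauss_monomial n x.
Proof. by rewrite /gauss_monomial exprS mulrA. Qed.

Lemma planar_monomialS j k a b : planar_monomial j k.+1 a b =
  fun z => planar_monomial j k a.+1 b z + 'i%C * planar_monomial j k a b.+1 z.
Proof.
apply/funext => z; rewrite /planar_monomial !gmS !rmorphM/= exprS.
rewrite [X in _ * (X * _) * _ = _]complexE; ring.
Qed.

Lemma planar_monomialSl j k a b : planar_monomial j.+1 k a b =
  fun z => planar_monomial j k a.+1 b z + - 'i%C * planar_monomial j k a b.+1 z.
Proof.
apply/funext => z; rewrite /planar_monomial !gmS !rmorphM/= exprS.
rewrite [X in X * _ * _ * _ = _](_ : _ = (complex.Re z)%:C - 'i%C * (complex.Im z)%:C).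
  ring.
by case: z => x y; apply/eqP; rewrite eq_complex /=; apply/andP; split; apply/eqP; ring.
Qed.

Lemma planar_monomial00 a b :
  planar_monomial 0 0 a b =
    fun z => (gauss_monomial a (complex.Re z) * gauss_monomial b (complex.Im z))%:C.
Proof. by apply/funext => z; rewrite /planar_monomial !expr0 !mul1r. Qed.

(** Lowering [j] and [k] leads to products of one-variable Gaussian monomials. *)
Lemma cintegrable_planar_monomial j k a b : cintegrable (planar_monomial j k a b).
Proof.
elim: j k a b => [|j ihj] k a b; last first.
  by rewrite planar_monomialSl; apply: cintegrableD => //; exact: cintegrableZ.
elim: k a b => [|k ihk] a b; last first.
  by rewrite planar_monomialS; apply: cintegrableD => //; exact: cintegrableZ.
rewrite planar_monomial00; split; last exact: integrable0.
by apply: integrable_prod_mul; exact: integrable_gauss_monomial.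
Qed.

Lemma planar_monomial_gauss j k :
  planar_monomial j k 0 0 = fun z => z^*%C ^+ j * z ^+ k * (expR (- (cabs z ^+ 2)))%:C.
Proof.
apply/funext => z; rewrite /planar_monomial /gauss_monomial !expr0 !mul1r.
rewrite /gauss_integral.gauss_fun -expRD; congr (_ * (expR _)%:C).
by case: z => x y; rewrite /cabs/= sqr_sqrtr ?addr_ge0 ?sqr_ge0//; ring.
Qed.

Let J j k a b := cintegral (planar_monomial j k a b).

Let J00 a b : J 0 0 a b = (gauss_moment R a * gauss_moment R b)%:C.
Proof.
rewrite /J planar_monomial00 /cintegral/= /gauss_moment -Rintegral_prod_mul.
- by rewrite /Rintegral integral0.
- exact: integrable_gauss_monomial.
- exact: integrable_gauss_monomial.
Qed.

Let JS j k a b : J j k.+1 a b = J j k a.+1 b + 'i%C * J j k a b.+1.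
Proof.
have := cintegrable_planar_monomial.
by move=> i; rewrite /J planar_monomialS cintegralD ?cintegralZ//; exact: cintegrableZ.
Qed.

Let JSl j k a b : J j.+1 k a b = J j k a.+1 b + - 'i%C * J j k a b.+1.
Proof.
have := cintegrable_planar_monomial.
by move=> i; rewrite /J planar_monomialSl cintegralD ?cintegralZ//; exact: cintegrableZ.
Qed.

Let J_parts j k a b :
  J j k a.+1 b = (a%:R * J j k a.-1 b + j%:R * J j.-1 k a b + k%:R * J j k.-1 a b) / 2 /\
  J j k a b.+1 = (b%:R * J j k a b.-1 + - 'i%C * (j%:R * J j.-1 k a b) +
                  'i%C * (k%:R * J j k.-1 a b)) / 2.
Proof.
apply: by_parts_recursion => // {j k a b} a b;
  by rewrite !J00 gauss_momentS !rmorphM/= fmorphV/= !rmorph_nat; ring.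
Qed.

(** At [a = b = 0], [i^2 = -1] makes the terms in [k] cancel and those in [j] add up. *)
Let J_raise j k : J j k.+1 0 0 = j%:R * J j.-1 k 0 0.
Proof.
rewrite JS !(J_parts j k _ _).1 !(J_parts j k _ _).2 /=.
have := sqr_i R; move: 'i%C => i i2; by field: i2.
Qed.

Let J_raisel j k : J j.+1 k 0 0 = k%:R * J j k.-1 0 0.
Proof.
rewrite JSl !(J_parts j k _ _).1 !(J_parts j k _ _).2 /=.
have := sqr_i R; move: 'i%C => i i2; by field: i2.
Qed.

(** Each step lowers both exponents by one: unequal ones end at a coefficient [0], equal ones
    collect [k!] on top of the Gaussian integral [pi]. *)
Lemma cintegral_gauss_monomial j k :
  cintegral (fun z : C => z^*%C ^+ j * z ^+ k * (expR (- (cabs z ^+ 2)))%:C) =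
  if j == k then (pi * k`!%:R)%:C else 0.
Proof.
rewrite -planar_monomial_gauss -/(J j k 0 0); elim: j k => [|j ih] [|k].
- by rewrite J00 gauss_moment0 -expr2 sqr_sqrtr ?pi_ge0 ?mulr1.
- by rewrite J_raise mul0r.
- by rewrite J_raisel mul0r.
- rewrite J_raisel ih eqSS; case: eqP => [_|_]; last by rewrite mulr0.
  by rewrite factS natrM !rmorphM/= rmorph_nat; ring.
Qed.

End PlanarMoments.

(** * Resolution of the identity for coherent states *)

Section ResolutionOfIdentity.
Variables (R : realType) (H : hilbertType R) (e : nat -> H).
Local Notation C := R[i].
Local Notation nu := (@lebesgue2 R).
Hypothesis he : orthonormal_basis e.
Let eo := he.1.

(** The Husimi function of [f], up to the factor [1 / pi]. *)
Definition husimi (f : H) (z : C) : R := cabs ⟨coherent_state e z, f⟩ ^+ 2.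

Let q := husimi.
Let qp f (p : R * R) : R := q f (Complex p.1 p.2).

Let q_ge0 f z : 0 <= q f z.
Proof. exact: sqr_ge0. Qed.

Let qE f z : (q f z)%:C = ⟨f, coherent_state e z⟩ * ⟨coherent_state e z, f⟩.
Proof. by rewrite /q /husimi -mulr_conjc mulrC -ipC. Qed.

Let partial f n := \sum_(0 <= i < n) ⟨e i, f⟩ *: e i.

Let partial_cvg f : partial f @ \oo --> f.
Proof. exact: (@he.2 f). Qed.

(** Expanding the square gives Gaussian monomials. The off-diagonal ones integrate to [0], the
    diagonal ones to [pi k!], and the factorial cancels against the coherent coefficients. *)
Lemma husimi_finite (a : nat -> C) n (u := \sum_(0 <= i < n) a i *: e i) :
  cintegrable (fun z => (q u z)%:C) /\
  cintegral (fun z => (q u z)%:C) = (pi * rnorm u ^+ 2)%:C.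
Proof.
have cM (x y : C) : (x * y)^*%C = x^*%C * y^*%C by exact: rmorphM.
have cX (x : C) k : (x ^+ k)^*%C = x^*%C ^+ k by exact: rmorphXn.
pose w k : C := ((Num.sqrt k`!%:R : R)%:C)^-1.
pose m j k (z : C) : C := z^*%C ^+ j * z ^+ k * (expR (- (cabs z ^+ 2)))%:C.
have im j k : cintegrable (m j k).
  rewrite /m; have := @cintegrable_planar_monomial R j k 0 0; congr cintegrable.
  exact: planar_monomial_gauss.
have -> : (fun z => (q u z)%:C) = (fun z => \sum_(0 <= j < n) \sum_(0 <= k < n)
    ((a k)^*%C * a j * w j * w k) * m j k z).
  apply/funext => z; rewrite qE (ipC u) /u !ip_sumr rmorph_sum/= mulrC mulr_suml.
  apply: eq_bigr => j _; rewrite mulr_sumr; apply: eq_bigr => k _.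
  rewrite !ipZr cM -(ipC (e k)) (ipC _ (e j)) !ip_e_coherent// cM conjc_real /m.
  (* The normalizing factors of the two coherent states combine into the Gaussian weight. *)
  have -> : (expR (- cabs z ^+ 2))%:C =
      (expR (- (cabs z ^+ 2 / 2)))%:C * (expR (- (cabs z ^+ 2 / 2)))%:C :> C.
    by rewrite -rmorphM/= -expRD; congr (expR _)%:C; field.
  rewrite /coherent_coef cM conjc_inv conjc_real cX -!/(w _).
  by ring.
have i1 j k : cintegrable (fun z => ((a k)^*%C * a j * w j * w k) * m j k z).
  exact: cintegrableZ.
have i2 j : cintegrable (fun z => \sum_(0 <= k < n) ((a k)^*%C * a j * w j * w k) * m j k z).
  exact: cintegrable_sum.
split; first exact: cintegrable_sum.
rewrite cintegral_sum// rnorm_sum// mulr_sumr rmorph_sum/=.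
apply: eq_big_nat => j jn; rewrite cintegral_sum//.
rewrite (bigD1_seq j) ?mem_index_iota ?iota_uniq//= big1 => [|k kj]; last first.
  by rewrite cintegralZ// cintegral_gauss_monomial eq_sym (negbTE kj) mulr0.
rewrite addr0 cintegralZ// cintegral_gauss_monomial eqxx [_^*%C * _]mulrC mulr_conjc.
rewrite -[_ * w j * w j]mulrA /w -invfM -rmorphM/= -expr2.
rewrite sqr_sqrtr ?ler0n// !rmorphM/=.
have : (j`!%:R : R)%:C != 0 :> C.
  by rewrite (inj_eq (@complexI R)) pnatr_eq0 -lt0n fact_gt0.
by move=> fn0; field.
Qed.

Let integral_q_finite a n (u := \sum_(0 <= i < n) a i *: e i) :
  nu.-integrable setT (EFin \o qp u) /\
  (\int[nu]_p (qp u p)%:E = (pi * rnorm u ^+ 2)%:E)%E.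
Proof.
have [[ir _] /(congr1 (@complex.Re R))/= iE] := husimi_finite a n.
split=> //; rewrite -iE /Rintegral fineK//.
exact: integrable_fin_num ir.
Qed.

Let cvg_qp f p : (fun n => qp (partial f n) p) @ \oo --> qp f p.
Proof.
rewrite /qp /q /husimi.
have h : (fun n => cabs ⟨coherent_state e (Complex p.1 p.2), partial f n⟩) @ \oo -->
    cabs ⟨coherent_state e (Complex p.1 p.2), f⟩.
  have := @rnorm_cvg R (C^o) _ _
    (@ipr_cvg _ _ (coherent_state e (Complex p.1 p.2)) _ _ (@partial_cvg f)).
  have nrC (z : C^o) : rnorm z = cabs z by rewrite /rnorm cabsE.
  by rewrite nrC; under eq_fun do rewrite nrC.
by rewrite expr2; under eq_fun do rewrite expr2; exact: cvgM.
Qed.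

(** A pointwise limit of the functions of the partial sums, measurable by the finite case. *)
Let measurable_qp f : measurable_fun setT (EFin \o qp f).
Proof.
apply/measurable_EFinP; apply: (measurable_fun_cvg _ (fun p _ => @cvg_qp f p)) => n.
apply/measurable_EFinP; have [/measurable_int + _] := integral_q_finite (fun i => ⟨e i, f⟩) n.
exact.
Qed.

Let cvg_rnorm_partial f : (fun n => pi * rnorm (partial f n) ^+ 2) @ \oo --> pi * rnorm f ^+ 2.
Proof.
apply: cvgMr; have /rnorm_cvg h := @partial_cvg f.
by rewrite expr2; under eq_fun do rewrite expr2; exact: cvgM.
Qed.

(** Fatou along the partial sums; both inferior limits are limits. *)
Let integral_qp_le f : (\int[nu]_p (qp f p)%:E <= (pi * rnorm f ^+ 2)%:E)%E.
Proof.
have f0 n p : setT p -> (0 <= (EFin \o qp (partial f n)) p)%E.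
  by move=> _; rewrite /= lee_fin; exact: q_ge0.
have := @fatou _ _ R nu setT measurableT (fun n => EFin \o qp (partial f n))
  (fun n => measurable_qp _) f0.
have -> : (fun n => \int[nu]_p (EFin \o qp (partial f n)) p)%E =
  (fun n => (pi * rnorm (partial f n) ^+ 2)%:E).
  by apply/funext => n; have [_ <-] := integral_q_finite (fun i => ⟨e i, f⟩) n.
have h : (fun n => (pi * rnorm (partial f n) ^+ 2)%:E) @ \oo --> (pi * rnorm f ^+ 2)%:E.
  by apply: cvg_EFin; [exact: nearW|exact: cvg_rnorm_partial].
have -> := (cvg_limn_einf_sup h).1.
rewrite (_ : (fun p => limn_einf _) = (fun p => (qp f p)%:E))//; apply/funext => p.
have hp : (fun n => (qp (partial f n) p)%:E) @ \oo --> (qp f p)%:E.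
  by apply: cvg_EFin; [exact: nearW|exact: cvg_qp].
by have [] := cvg_limn_einf_sup hp.
Qed.

Let integrable_qp f : nu.-integrable setT (EFin \o qp f).
Proof.
apply/integrableP; split; first exact: measurable_qp.
apply: le_lt_trans (ltry (pi * rnorm f ^+ 2)); apply: le_trans (integral_qp_le f).
rewrite le_eqVlt; apply/orP; left; apply/eqP; apply: eq_integral => p _ /=.
by rewrite ger0_norm ?q_ge0.
Qed.

Let Iq f := Rintegral nu setT (qp f).

Let Iq_le f : Iq f <= pi * rnorm f ^+ 2.
Proof.
rewrite -lee_fin /Iq /Rintegral fineK; first exact: integral_qp_le.
exact: integrable_fin_num (integrable_qp f).
Qed.

Let Iq_partial f n : Iq (partial f n) = pi * rnorm (partial f n) ^+ 2.
Proof.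
by have [_] := integral_q_finite (fun i => ⟨e i, f⟩) n; rewrite /Iq /Rintegral => ->.
Qed.

(** With [a] and [d] the moduli for [f] and [f - g], the triangle inequality leaves the gap
    [eps^-1 (eps a - d)^2], which is nonnegative. *)
Let q_split f g (eps : R) z : 0 < eps ->
  q g z <= (1 + eps) * q f z + (1 + eps^-1) * q (f - g) z.
Proof.
move=> e0; rewrite /q /husimi ipBr; set x := ⟨_, f⟩; set y := ⟨_, g⟩.
have : cabs y <= cabs x + cabs (x - y).
  rewrite -lecR rmorphD/= -!cabsE -[X in `|X| <= _](subKr x); exact: ler_normB.
move: (cabs_ge0 y) (cabs_ge0 x) (cabs_ge0 (x - y)).
move: (cabs x) (cabs (x - y)) (cabs y) => a d b b0 a0 d0 h.
have : b ^+ 2 <= (a + d) ^+ 2 by rewrite ler_sqr ?nnegrE ?addr_ge0.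
move=> /le_trans; apply; rewrite -subr_ge0.
have -> : (1 + eps) * a ^+ 2 + (1 + eps^-1) * d ^+ 2 - (a + d) ^+ 2 =
   eps^-1 * (eps * a - d) ^+ 2 by field; rewrite gt_eqF.
by rewrite mulr_ge0 ?sqr_ge0// invr_ge0 ltW.
Qed.

Let integrable_qpZ (r : R) f : nu.-integrable setT (EFin \o (fun p => r * qp f p)).
Proof. exact: (integrableZl measurableT r (integrable_qp f)). Qed.

Let Iq_split f g (eps : R) : 0 < eps -> Iq g <= (1 + eps) * Iq f + (1 + eps^-1) * Iq (f - g).
Proof.
move=> e0; have IZ r h : r * Iq h = Rintegral nu setT (fun p => r * qp h p).
  by rewrite /Iq RintegralZl//; exact: integrable_qp.
rewrite !IZ /Iq -RintegralD//; try exact: integrable_qpZ.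
apply: le_Rintegral => //; [exact: integrable_qp| |by move=> p _; exact: q_split].
exact: (integrableD measurableT (integrable_qpZ _ _) (integrable_qpZ _ _)).
Qed.

(** In [Iq_split] for [f] and its partial sums, [Iq_le] sends the remainder to [0]; then [eps] is
    made small. *)
Let Iq_ge f : pi * rnorm f ^+ 2 <= Iq f.
Proof.
have step eps : 0 < eps -> pi * rnorm f ^+ 2 <= (1 + eps) * Iq f.
  move=> e0.
  apply: (@ler_cvg_to _ \oo _ _ (fun n => pi * rnorm (partial f n) ^+ 2)
    (fun n => (1 + eps) * Iq f + (1 + eps^-1) * (pi * rnorm (f - partial f n) ^+ 2))).
  - exact: cvg_rnorm_partial.
  - rewrite -[X in _ --> X]addr0; apply: cvgD; first exact: cvg_cst.
    rewrite -[X in _ --> X](mulr0 (1 + eps^-1)); apply: cvgMr.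
    rewrite -[X in _ --> X](mulr0 pi); apply: cvgMr.
    have /cvg_rnorm h := @partial_cvg f.
    rewrite -[X in _ --> X](mulr0 0); under eq_fun do rewrite expr2; exact: cvgM.
  - apply: nearW => n; rewrite -Iq_partial.
    apply: le_trans (Iq_split f _ e0) _; rewrite lerD2l ler_wpM2l//.
    by rewrite addr_ge0// invr_ge0 ltW.
have Iq0 : 0 <= Iq f by apply: Rintegral_ge0 => p _.
apply/ler_addgt0Pr => d d0.
have Iq1 : 0 < Iq f + 1 by rewrite ltr_wpDl.
(* This choice of [eps] makes [eps * Iq f <= d]; the added [1] keeps the denominator positive. *)
apply: le_trans (step (d / (Iq f + 1)) (divr_gt0 d0 Iq1)) _.
rewrite mulrDl mul1r lerD2l -mulrA ler_piMr ?(ltW d0)//.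
by rewrite mulrC ler_pdivrMr// mul1r lerDl.
Qed.

Lemma cintegrable_husimi f : cintegrable (fun z => (q f z)%:C).
Proof. by split; [exact: integrable_qp|exact: integrable0]. Qed.

Lemma cintegral_husimi f : cintegral (fun z => (q f z)%:C) = (pi * rnorm f ^+ 2)%:C.
Proof.
rewrite /cintegral/= [Rintegral _ _ (fun=> 0)]/Rintegral integral0.
by congr (_ +i* _); apply/eqP; rewrite eq_le Iq_le Iq_ge.
Qed.

(** Polarization of the sesquilinear form [<f, h> <h, g>] in [f] and [g]; on the diagonal, with [h]
    a coherent state, it is the Husimi function. *)
Lemma ip_polarization (f g h : H) : ⟨f, h⟩ * ⟨h, g⟩ = 4^-1 *
  (⟨g + f, h⟩ * ⟨h, g + f⟩ + -1 * (⟨g - f, h⟩ * ⟨h, g - f⟩) +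
   'i%C * (⟨g + 'i%C *: f, h⟩ * ⟨h, g + 'i%C *: f⟩) +
   - 'i%C * (⟨g - 'i%C *: f, h⟩ * ⟨h, g - 'i%C *: f⟩)).
Proof.
rewrite !(ipDr, ipNr, ipZr, ipDl, ipNl, ipZl).
have -> : ('i%C)^*%C = - 'i%C :> C by apply/eqP; rewrite eq_complex/= !oppr0 !eqxx.
by have := sqr_i R; move: 'i%C => i i2; field: i2.
Qed.

Lemma rnorm_polarization (f g : H) : ⟨f, g⟩ = 4^-1 *
  ((rnorm (g + f) ^+ 2)%:C + -1 * (rnorm (g - f) ^+ 2)%:C +
   'i%C * (rnorm (g + 'i%C *: f) ^+ 2)%:C + - 'i%C * (rnorm (g - 'i%C *: f) ^+ 2)%:C).
Proof.
rewrite -!ipff !(ipDr, ipNr, ipZr, ipDl, ipNl, ipZl).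
have -> : ('i%C)^*%C = - 'i%C :> C by apply/eqP; rewrite eq_complex/= !oppr0 !eqxx.
by have := sqr_i R; move: 'i%C => i i2; field: i2.
Qed.

(** Integrand and inner product are polarized with the same four vectors, so [cintegral_husimi]
    settles each term. *)
Lemma resolution_of_identity f g
    (h := fun z => ⟨f, coherent_state e z⟩ * ⟨coherent_state e z, g⟩) :
  cintegrable h /\ cintegral h = pi%:C * ⟨f, g⟩.
Proof.
have -> : h = fun z => 4^-1 * ((q (g + f) z)%:C + -1 * (q (g - f) z)%:C +
   'i%C * (q (g + 'i%C *: f) z)%:C + - 'i%C * (q (g - 'i%C *: f) z)%:C).
  by apply/funext => z; rewrite /h ip_polarization !qE.
have iq := cintegrable_husimi.
have iqZ a u : cintegrable (fun z => a * (q u z)%:C) by apply: cintegrableZ.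
have i1 := cintegrableD (iq (g + f)) (iqZ (-1) (g - f)).
have i2 := cintegrableD i1 (iqZ 'i%C (g + 'i%C *: f)).
have i3 := cintegrableD i2 (iqZ (- 'i%C) (g - 'i%C *: f)).
split; first exact: cintegrableZ.
rewrite cintegralZ// cintegralD// cintegralD// cintegralD// !cintegralZ// !cintegral_husimi.
by rewrite rnorm_polarization !rmorphM/=; ring.
Qed.

End ResolutionOfIdentity.

(** * Similarity transforms of unbounded operators *)

Section Conjugation.
Variables (R : realType) (H : hilbertType R).

Definition conj_operator (S Sinv : H -> H) (A : operator H) : operator H :=
  Operator [set f | op_dom A (Sinv f)] (fun f => S (A (Sinv f))).

Lemma conj_operator_linear (S Sinv : {linear H -> H}) (A : operator H) :
  linear_operator A -> linear_operator (conj_operator S Sinv A).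
Proof.
move=> [[A0 AS] AL]; split; first split.
- by rewrite /= linear0.
- by move=> a f g fA gA; rewrite /= linearP; exact: AS.
- by move=> a f g fA gA; rewrite /= linearP AL// linearP.
Qed.

End Conjugation.

(** * The three claims for Riesz bicoherent states *)

Theorem proposition4 (R : realType) (H : hilbertType R)
    (e : nat -> H) (he : orthonormal_basis e)
    (c : operator H) (hc : annihilation_operator e c)
    (T Tinv : {linear H -> H}) (hT : bounded_operator T) (hTinv : bounded_operator Tinv)
    (hTK : cancel T Tinv) (hTinvK : cancel Tinv T)
    (eta xi : R[i] -> H)
    (heta : forall z, eta z = T (coherent_state e z))
    (hxi : forall z, xi z = badjoint Tinv (coherent_state e z)) :
  [/\ forall z, ⟨eta z, xi z⟩ = 1,
      forall f g,
        cintegrable (fun z => ⟨f, eta z⟩ * ⟨xi z, g⟩) /\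
        ⟨f, g⟩ = (pi^-1)%:C * cintegral (fun z => ⟨f, eta z⟩ * ⟨xi z, g⟩) &
      forall D : set H,
        dense D -> subspace D ->
        (T @` D `<=` D) -> (badjoint T @` D `<=` D) ->
        (Tinv @` D `<=` D) -> (badjoint Tinv @` D `<=` D) ->
        stable_under D c -> stable_under D (adjoint c) ->
        (forall z, D (coherent_state e z)) ->
        exists a b : operator H,
          [/\ linear_operator a, linear_operator b,
              stable_under D a /\ stable_under D b,
              stable_under D (adjoint a) /\ stable_under D (adjoint b) &
              [/\ forall f, D f -> a (b f) - b (a f) = f,
                  forall z, a (eta z) = z *: eta z &
                  forall z, adjoint b (xi z) = z *: xi z]]].
Proof.
have Tadj := badjointP he hT; have Sadj := badjointP he hTinv.
split.
(* [Tinv] crosses the inner product and meets [T], leaving the unit norm of the coherent state. *)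
- move=> z; rewrite heta hxi ipC Sadj hTK ipff rnorm_coherent// expr1n.
  exact: conjc_real.
- move=> f g.
  (* The claim becomes the resolution of the identity for [badjoint T f] and [Tinv g], whose inner
     product is [<f, g>]. *)
  have -> : (fun z => ⟨f, eta z⟩ * ⟨xi z, g⟩) =
      (fun z => ⟨badjoint T f, coherent_state e z⟩ * ⟨coherent_state e z, Tinv g⟩).
    by apply/funext => z; rewrite heta hxi Sadj Tadj.
  have [ih ->] := resolution_of_identity he (badjoint T f) (Tinv g); split=> //.
  by rewrite mulrA -rmorphM/= mulVf ?gt_eqF ?pi_gt0// mul1r Tadj hTinvK.
move=> D dD sD TD TaD SD SaD [Dc cD] [Da aD] PhiD.
have [lc _ _ _] := hc.
have {}TD f : D f -> D (T f) by move=> Df; apply: TD; exists f.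
have {}TaD f : D f -> D (badjoint T f) by move=> Df; apply: TaD; exists f.
have {}SD f : D f -> D (Tinv f) by move=> Df; apply: SD; exists f.
have {}SaD f : D f -> D (badjoint Tinv f) by move=> Df; apply: SaD; exists f.
have {}cD f : D f -> D (c f) by move=> Df; apply: cD; exists f.
have {}aD f : D f -> D (adjoint c f) by move=> Df; apply: aD; exists f.
have dc : dense (op_dom c) by exact: denseW Dc dD.
pose a := conj_operator T Tinv c; pose b := conj_operator T Tinv (adjoint c).
have Da' : D `<=` op_dom a by move=> f Df; apply: Dc; exact: SD.
have Db' : D `<=` op_dom b by move=> f Df; apply: Da; exact: SD.
(* The domain of [a] contains [D], hence is dense, and the adjoint is found by moving [T], [c] and
   [Tinv] across in turn. *)
have adja g : D g -> op_dom (adjoint a) g /\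
    adjoint a g = badjoint Tinv (adjoint c (badjoint T g)).
  move=> Dg; apply: adjoint_eq; first exact: denseW Da' dD.
  by move=> f fa; rewrite -Tadj Sadj adjointP//; exact/Da/TaD.
have adjb g : D g -> op_dom (adjoint b) g /\
    adjoint b g = badjoint Tinv (c (badjoint T g)).
  move=> Dg; apply: adjoint_eq; first exact: denseW Db' dD.
  (* Conjugate symmetry reads the adjoint relation of [c] backwards: [c] acts as the adjoint of
     [adjoint c] on [D]. *)
  move=> f fb; rewrite -Tadj Sadj ipC [RHS]ipC -adjointP//; exact/Dc/TaD.
exists a, b; split.
- exact: conj_operator_linear.
- by apply: conj_operator_linear; exact: adjoint_linear.
- by split; split=> // _ [f Df <-]; apply: TD; [apply: cD|apply: aD]; exact: SD.
- split; split.
  + by move=> f /adja[].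
  + by move=> _ [f Df <-]; rewrite (adja f Df).2; exact/SaD/aD/TaD.
  + by move=> f /adjb[].
  + by move=> _ [f Df <-]; rewrite (adjb f Df).2; exact/SaD/cD/TaD.
split.
(* The inner [Tinv] and [T] cancel, so the commutator is that of [c] and [adjoint c], conjugated by
   [T]. *)
- move=> f /SD Df; rewrite /= !hTK -linearB.
  rewrite (annihilation_commutator he hc) ?hTinvK//.
  + exact: Dc.
  + exact: Da.
  + exact/Dc/aD.
  + exact/Da/cD.
- by move=> z; rewrite heta /= hTK (annihilation_coherent he hc z).2 linearZ.
- move=> z; rewrite hxi (adjb _ (SaD _ (PhiD z))).2.
  (* The two adjoints are mutually inverse because [T] and [Tinv] are, as seen by pairing with
     [D]. *)
  have -> : badjoint T (badjoint Tinv (coherent_state e z)) = coherent_state e z.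
    apply/subr0_eq/(dense_ip_eq0 dD) => f _.
    by rewrite ipBl Tadj Sadj hTK subrr.
  rewrite (annihilation_coherent he hc z).2.
  (* [badjoint Tinv] is a bare function, so the scalar [z] is pulled out by pairing with [D]. *)
  apply/subr0_eq/(dense_ip_eq0 dD) => f _.
  by rewrite ipBl ipZl !Sadj ipZl subrr.
Qed.
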